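(* Consider the multi-demand auction model with item types $N=\{1,\dots,n\}$, supply vector $u$, bidders $M=\{1,\dots,m\}$, and valuation functions $v_b:[\mathbf 0,u]_{\mathbb Z}\to\mathbb Z$ $(b\in M)$ that are monotone nondecreasing, satisfy $v_b(\mathbf 0)=0$, and are M$^\natural$-concave. Let $p^*_{\min}$ be the unique minimal (Walrasian) equilibrium price vector. Run the algorithm Ascending Auction from an initial vector $p^\circ\in\mathbb Z^n_+$ with $p^\circ\le p^*_{\min}$. If, in each iteration, the item set $X$ selected in Step 2 is an excess-demand set at price $p$, i.e., $X$ is nonempty and $$\sum_{b\in M}\bigl(\mu_b(X;p)-\mu_b(X\setminus Z;p)\bigr)>u(Z)\qquad\text{for every nonempty } Z\subseteq X,$$ then the algorithm finds $p^*_{\min}$; that is, it terminates and the vector $p$ at termination equals $p^*_{\min}$.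
   Context: Multi-demand model. $N=\{1,\dots,n\}$ is the set of item types, $u=(u(1),\dots,u(n))$ is a vector of positive integers ($u(i)$ is the number of supplied units of item $i$), $M=\{1,\dots,m\}$ is the set of bidders, and $[\mathbf 0,u]_{\mathbb Z}=\{x\in\mathbb Z^n\mid 0\le x(i)\le u(i)\ (i\in N)\}$. Each bidder $b\in M$ has a valuation function $v_b:[\mathbf 0,u]_{\mathbb Z}\to\mathbb Z$, monotone nondecreasing with $v_b(\mathbf 0)=0$. For $p\in\mathbb Z^n_+$ the demand set is $D_b(p)=\arg\max\{v_b(x)-p^\top x\mid x\in[\mathbf 0,u]_{\mathbb Z}\}$. An allocation is a family $x_1,\dots,x_m\in[\mathbf 0,u]_{\mathbb Z}$ with $\sum_{b=1}^m x_b=u$. A pair of a price vector $p^*\in\mathbb Z^n_+$ and an allocation $x^*_1,\dots,x^*_m$ with $x^*_b\in D_b(p^* )$ for all $b\in M$ is a (Walrasian) equilibrium, and $p^*$ is then a (Walrasian) equilibrium price vector. When all $v_b$ are M$^\natural$-concave, an equilibrium exists and there is a unique minimal equilibrium price vector (componentwise order), denoted $p^*_{\min}$. M$^\natural$-concavity. For $i\in N$, $\chi_i$ is the $i$th unit vector, and $\chi_0=\mathbf 0$. For $z\in\mathbb Z^n$, $\mathrm{supp}^+(z)=\{i\in N\mid z(i)>0\}$ and $\mathrm{supp}^-(z)=\{i\in N\mid z(i)<0\}$. A function $v:[\mathbf 0,u]_{\mathbb Z}\to\mathbb Z$ is M$^\natural$-concave if for all $x,y\in[\mathbf 0,u]_{\mathbb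 Z}$ and all $i\in\mathrm{supp}^+(x-y)$ there exists $k\in\mathrm{supp}^-(x-y)\cup\{0\}$ with $v(x)+v(y)\le v(x-\chi_i+\chi_k)+v(y+\chi_i-\chi_k)$. Overdemanded sets. For $y\in\mathbb Z^n$ and $X\subseteq N$, $y(X)=\sum_{i\in X}y(i)$. For $p\in\mathbb Z^n_+$ and $X\subseteq N$ let $\mu_b(X;p)=\min\{y(X)\mid y\in D_b(p)\}$ $(b\in M)$. The set $X$ is overdemanded at $p$ if $\sum_{b\in M}\mu_b(X;p)>u(X)$. (An excess-demand set is overdemanded: take $Z=X$.) Algorithm Ascending Auction. ($\chi_X\in\{0,1\}^n$ is the characteristic vector of $X$.) Step 0: Set $p:=p^\circ$, where $p^\circ\in\mathbb Z^n_+$ satisfies $p^\circ\le p^*_{\min}$. Step 1: If there is no overdemanded set at price $p$, then stop. Step 2: Find an item set $X\subseteq N$ that is overdemanded at price $p$. Step 3: Set $p:=p+\chi_X$ and go to Step 1. *)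

(* Defs.v *)
From HB Require Import structures.
From mathcomp Require Import all_boot all_order all_algebra.

Set Implicit Arguments.
Unset Strict Implicit.
Unset Printing Implicit Defensive.

Import Order.TTheory GRing.Theory Num.Theory.
Local Open Scope ring_scope.

(* The integer box [0,u]_Z, as a finite type. *)
Notation bundle u := {dffun forall i, 'I_(u i).+1}.

Notation price n := {ffun 'I_n -> nat}.

Section Valuations.

Variables (n : nat) (u : {ffun 'I_n -> nat}).

Definition bvec (x : bundle u) : {ffun 'I_n -> int} :=
  [ffun i => (x i : nat)%:Z].

(* chi_k for k in N \cup {0}: the index 0 is encoded as None. *)
Definition chi (k : option 'I_n) : {ffun 'I_n -> int} :=
  [ffun j => if k == Some j then 1 else 0].

Definition supp_pos (z : {ffun 'I_n -> int}) : {set 'I_n} :=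
  [set i | 0 < z i].

Definition supp_neg (z : {ffun 'I_n -> int}) : {set 'I_n} :=
  [set i | z i < 0].

Definition monotone_valuation (v : bundle u -> int) : Prop :=
  forall x y : bundle u, (forall i, (x i <= y i)%N) -> v x <= v y.

(* As v is only defined on the box, the vectors x - chi_i + chi_k and
   y + chi_i - chi_k are named by bundles x' and y'; the conditions on i and k
   guarantee that both vectors do lie in the box. *)
Definition Mnat_concave (v : bundle u -> int) : Prop :=
  forall (x y : bundle u) (i : 'I_n), i \in supp_pos (bvec x - bvec y) ->
  exists k : option 'I_n,
    (if k is Some j then j \in supp_neg (bvec x - bvec y) else true) /\
    exists x' y' : bundle u,
      [/\ bvec x' = bvec x - chi (Some i) + chi k,
          bvec y' = bvec y + chi (Some i) - chi k
        & v x + v y <= v x' + v y'].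

Definition payoff (v : bundle u -> int) (p : price n) (x : bundle u) : int :=
  v x - \sum_(i < n) (p i)%:Z * (x i : nat)%:Z.

Definition demand (v : bundle u -> int) (p : price n) : {set bundle u} :=
  [set x | [forall y, payoff v p y <= payoff v p x]].

(* The default value u(X) of the iterated minimum is an upper bound of all the
   y(X), and demand sets are nonempty (the box is finite and nonempty), so this
   is the true minimum of y(X) over the demand set. *)
Definition mu (v : bundle u -> int) (X : {set 'I_n}) (p : price n) : nat :=
  \big[minn/(\sum_(i in X) u i)%N]_(y in demand v p) (\sum_(i in X) y i)%N.

End Valuations.

Section Auction.

Variables (n m : nat) (u : {ffun 'I_n -> nat}) (v : 'I_m -> bundle u -> int).

Definition price_le (p q : price n) : Prop := forall i, (p i <= q i)%N.

Definition allocation (x : 'I_m -> bundle u) : Prop :=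
  forall i, (\sum_(b < m) x b i)%N = u i.

Definition equilibrium (p : price n) (x : 'I_m -> bundle u) : Prop :=
  allocation x /\ forall b, x b \in demand (v b) p.

Definition equilibrium_price (p : price n) : Prop :=
  exists x : 'I_m -> bundle u, equilibrium p x.

Definition minimal_equilibrium_price (p : price n) : Prop :=
  equilibrium_price p /\
  forall q, equilibrium_price q -> price_le q p -> q = p.

Definition overdemanded (p : price n) (X : {set 'I_n}) : bool :=
  (\sum_(i in X) u i < \sum_(b < m) mu (v b) X p)%N.

Definition excess_demand (p : price n) (X : {set 'I_n}) : Prop :=
  X != set0 /\
  forall Z : {set 'I_n}, Z != set0 -> Z \subset X ->
    (\sum_(i in Z) u i)%N%:Z <
      \sum_(b < m) ((mu (v b) X p)%:Z - (mu (v b) (X :\: Z) p)%:Z).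

Definition has_overdemanded (p : price n) : bool :=
  [exists X : {set 'I_n}, overdemanded p X].

Definition raise (p : price n) (X : {set 'I_n}) : price n :=
  [ffun i => (p i + (i \in X))%N].

(* A run of Ascending Auction: p t is the price vector after t iterations and
   X t the set selected in Step 2 of the next one.  The choice of X t is
   arbitrary among the overdemanded sets and may depend on the history.  Once
   the stopping test of Step 1 succeeds the price stays constant, and X t is
   then meaningless. *)
Definition auction_run (p0 : price n) (p : nat -> price n)
    (X : nat -> {set 'I_n}) : Prop :=
  p 0%N = p0 /\
  forall t, if has_overdemanded (p t)
            then overdemanded (p t) (X t) /\ p t.+1 = raise (p t) (X t)
            else p t.+1 = p t.

Definition stops_at (p : nat -> price n) (q : price n) : Prop :=
  exists T, [/\ forall t, (t < T)%N -> has_overdemanded (p t),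
                ~~ has_overdemanded (p T)
              & p T = q].

End Auction.

(* Main.v *)
Require Import Defs.
From HB Require Import structures.
From mathcomp Require Import all_boot all_order all_algebra.
From mathcomp Require Import zify.

Set Implicit Arguments.
Unset Strict Implicit.
Unset Printing Implicit Defensive.

Import Order.TTheory GRing.Theory Num.Theory.
Local Open Scope ring_scope.

(** Write V_b(p) for the largest payoff of bidder b at price p.  The proof
    rests on the Lyapunov function L(p) = sum_b V_b(p) + p . u.  For every
    allocation x, L(p) exceeds sum_b v_b(x_b) by the sum of the regrets
    V_b(p) - payoff_b(p, x_b), so that once one equilibrium exists the
    equilibrium prices are exactly the minimizers of L
    ([equilibrium_price_min], [equilibrium_price_of_min]).

    Everything about M-natural-concavity is drawn from one fact,
    [common_demand_raise]: raising the prices of a set S by one leaves some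
    bundle z that is demanded both before and after.  It has two consequences.
    - V_b(p + chi_X) = V_b(p) - mu_b(X; p), as z attains the minimum mu_b
      ([indirect_utility_raise]).  Hence X is overdemanded exactly when
      L(p + chi_X) < L(p), and X is an excess-demand set only if
      L(p + chi_X) < L(p + chi_(X - Z)) for all nonempty Z inside X.
    - V_b, and therefore L, is discretely midpoint convex: if r + s is
      p + (p + chi_S), the values at p and p + chi_S sum to at most those at
      r and s, because the two payoffs of the same bundle z have equal sums
      ([indirect_utility_midpoint]).

    Midpoint convexity gives the two halves of the theorem.  First, the price
    never passes pmin ([excess_demand_raise_le]): if p <= pmin and Z is the
    set of items of X whose price is already that of pmin, submodularity shows
    that raising Z costs at least as much in L from p + chi_(X - Z) as from
    pmin, where the cost is nonnegative; the excess-demand inequality says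
    that it is negative from p + chi_(X - Z), so Z is empty.  Second, if
    p <= pmin does not minimize L, bisection between p and pmin leads to some
    X with L(p + chi_X) < L(p), so that the algorithm does not stop before p
    is an equilibrium price ([no_overdemanded_eq_min]).  As the total price
    grows in each iteration and is bounded by that of pmin, the algorithm
    stops. *)

(** * Payoffs and exchanges of single units *)

Lemma Posz_sum (I : Type) (r : seq I) (P : pred I) (F : I -> nat) :
  (\sum_(i <- r | P i) F i)%N%:Z = \sum_(i <- r | P i) (F i)%:Z.
Proof. exact: (big_morph Posz PoszD). Qed.

Definition l1norm (n : nat) (z : {ffun 'I_n -> int}) : nat :=
  (\sum_i `|z i|)%N.

(** Extends the prices to the index 0 of the null exchange, which is [None]. *)
Definition price_at (n : nat) (p : price n) (k : option 'I_n) : int :=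
  if k is Some j then (p j)%:Z else 0.

Lemma payoffE (n : nat) (u : {ffun 'I_n -> nat}) (v : bundle u -> int)
    (p : price n) (x : bundle u) :
  payoff v p x = v x - \sum_(i < n) (p i)%:Z * bvec x i.
Proof. by congr (_ - _); apply: eq_bigr => i _; rewrite ffunE. Qed.

Lemma sum_price_chi (n : nat) (p : price n) (k : option 'I_n) :
  \sum_(i < n) (p i)%:Z * chi k i = price_at p k.
Proof.
case: k => [j|] /=; last by apply: big1 => i _; rewrite ffunE mulr0.
rewrite (bigD1 j) //= ffunE eqxx mulr1 big1 ?addr0 // => i ij.
by rewrite ffunE (inj_eq Some_inj) eq_sym (negPf ij) mulr0.
Qed.

Lemma payoff_exchange (n : nat) (u : {ffun 'I_n -> nat}) (v : bundle u -> int)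
    (p : price n) (x y : bundle u) (k l : option 'I_n) :
  bvec y = bvec x - chi k + chi l ->
  payoff v p y = payoff v p x - v x + v y + price_at p k - price_at p l.
Proof.
move=> e; suff : \sum_(i < n) (p i)%:Z * bvec y i =
    \sum_(i < n) (p i)%:Z * bvec x i - price_at p k + price_at p l.
  by rewrite !payoffE; lia.
rewrite -!sum_price_chi -sumrB -big_split /=; apply: eq_bigr => i _.
by rewrite e [(_ + _ : {ffun _}) i]ffunE [(_ + _ : {ffun _}) i]ffunE
  [(- _ : {ffun _}) i]ffunE mulrDr mulrBr.
Qed.

(** An exchange step moves the two bundles towards each other; this is the
    termination measure for repeated exchanges. *)
Lemma l1norm_exchange (n : nat) (z : {ffun 'I_n -> int}) (i : 'I_n)
    (k : option 'I_n) :
  i \in supp_pos z -> (forall j, k = Some j -> j \in supp_neg z) ->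
  (l1norm (z - chi (Some i) + chi k)%R < l1norm z)%N.
Proof.
rewrite inE => zi hk; rewrite /l1norm (bigD1 i) //= [ltnRHS](bigD1 i) //=.
have hki : k != Some i.
  by apply/eqP => /hk; rewrite inE => zi'; move: (lt_trans zi zi'); rewrite ltxx.
rewrite -addSn; apply: leq_add; first by rewrite !ffunE eqxx (negPf hki) /=; lia.
apply: leq_sum => j ji; rewrite !ffunE (inj_eq Some_inj) eq_sym (negPf ji).
case: (eqVneq k (Some j)) => [/hk|_]; last by rewrite /=; lia.
by rewrite inE /=; lia.
Qed.

Lemma bvec_inj (n : nat) (u : {ffun 'I_n -> nat}) (x y : bundle u) :
  (forall i, bvec x i = bvec y i) -> x = y.
Proof. by move=> e; apply/ffunP => i; apply: val_inj; have := e i; rewrite !ffunE; case. Qed.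

Lemma l1normN (n : nat) (z : {ffun 'I_n -> int}) : l1norm (- z) = l1norm z.
Proof. by apply: eq_bigr => i _; rewrite ffunE abszN. Qed.

(** * Bundles demanded at two close prices *)

Lemma demandP (n : nat) (u : {ffun 'I_n -> nat}) (v : bundle u -> int)
    (p : price n) (x : bundle u) :
  reflect (forall y, payoff v p y <= payoff v p x) (x \in demand v p).
Proof. by rewrite inE; apply: forallP. Qed.

Lemma notin_demand (n : nat) (u : {ffun 'I_n -> nat}) (v : bundle u -> int)
    (p : price n) (x y : bundle u) :
  x \in demand v p -> y \notin demand v p -> payoff v p y < payoff v p x.
Proof.
move=> /demandP hx; apply: contraR; rewrite -leNgt => le_xy.
by apply/demandP => z; apply: le_trans le_xy.
Qed.

(** The exchange raises the sum of the two payoffs by the difference between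
    the price gaps of the two exchanged indices, hence by at least -1 when the
    price gaps differ by at most 1.  If both new bundles were outside the
    respective demand sets, integrality would make this change at most -2. *)
Lemma demand_exchange (n : nat) (u : {ffun 'I_n -> nat}) (v : bundle u -> int)
    (p q : price n) (x y : bundle u) (i : 'I_n) :
  Mnat_concave v ->
  (forall k l, price_at p k - price_at q k <= price_at p l - price_at q l + 1) ->
  x \in demand v p -> y \in demand v q -> i \in supp_pos (bvec x - bvec y) ->
  exists x' y', [/\ x' \in demand v p, y' \in demand v q
    & (l1norm (bvec x' - bvec y')%R < l1norm (bvec x - bvec y)%R)%N].
Proof.
move=> hv close hx hy hi.
have [k [hk [x' [y' [ex ey hsum]]]]] := hv _ _ _ hi.
have hk' j : k = Some j -> j \in supp_neg (bvec x - bvec y) by move=> e; rewrite e in hk.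
have shorter := l1norm_exchange hi hk'.
have [hx'|hx'] := boolP (x' \in demand v p).
  by exists x', y; split=> //; rewrite ex addrAC [bvec x - _ - _]addrAC.
have [hy'|hy'] := boolP (y' \in demand v q).
  exists x, y'; split=> //.
  by rewrite ey !opprD opprK !addrA.
have lt1 := notin_demand hx hx'; have lt2 := notin_demand hy hy'.
have := payoff_exchange v p ex.
have := @payoff_exchange _ _ v q y y' k (Some i).
rewrite ey addrAC => /(_ erefl).
have := close k (Some i); lia.
Qed.

(** A pair of demanded bundles at minimal distance must coincide, as otherwise
    an exchange brings them closer. *)
Lemma common_demand_close (n : nat) (u : {ffun 'I_n -> nat})
    (v : bundle u -> int) (p q : price n) (x y : bundle u) :
  Mnat_concave v ->
  (forall k l, price_at p k - price_at q k <= price_at p l - price_at q l + 1) ->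
  x \in demand v p -> y \in demand v q ->
  exists z, z \in demand v p /\ z \in demand v q.
Proof.
move=> hv close; have [N] := ubnP (l1norm (bvec x - bvec y)).
elim: N x y => // N IHN x y ltN hx hy.
have [/forallP e|/forallPn [i]] := boolP [forall i, bvec x i == bvec y i].
  by exists x; split=> //; rewrite (@bvec_inj _ _ x y) // => i; apply/eqP.
rewrite neq_lt => /orP[lt_xy|lt_yx].
- have hi : i \in supp_pos (bvec y - bvec x) by rewrite inE !ffunE in lt_xy *; lia.
  have close' k l : price_at q k - price_at p k <= price_at q l - price_at p l + 1.
    by have := close l k; lia.
  have [y' [x' [hy' hx' lt]]] := demand_exchange hv close' hy hx hi.
  apply: IHN hx' hy'; rewrite -l1normN opprB.
  by apply: leq_trans lt _; rewrite -l1normN opprB -ltnS.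
- have hi : i \in supp_pos (bvec x - bvec y) by rewrite inE !ffunE in lt_yx *; lia.
  have [x' [y' [hx' hy' lt]]] := demand_exchange hv close hx hy hi.
  by apply: IHN hx' hy'; apply: leq_trans lt _; rewrite -ltnS.
Qed.

(** * The indirect utility function *)

Definition best_bundle (n : nat) (u : {ffun 'I_n -> nat}) (v : bundle u -> int)
    (p : price n) : bundle u :=
  [arg max_(x > [ffun i => ord0] : bundle u) payoff v p x]%O.

Definition indirect_utility (n : nat) (u : {ffun 'I_n -> nat})
    (v : bundle u -> int) (p : price n) : int :=
  payoff v p (best_bundle v p).

Lemma best_bundle_demand (n : nat) (u : {ffun 'I_n -> nat})
    (v : bundle u -> int) (p : price n) : best_bundle v p \in demand v p.
Proof.
apply/demandP => y; rewrite /best_bundle.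
by case: arg_maxP => // x _ /(_ y isT).
Qed.

Lemma payoff_le (n : nat) (u : {ffun 'I_n -> nat}) (v : bundle u -> int)
    (p : price n) (x : bundle u) : payoff v p x <= indirect_utility v p.
Proof. exact/demandP/best_bundle_demand. Qed.

Lemma demandE (n : nat) (u : {ffun 'I_n -> nat}) (v : bundle u -> int)
    (p : price n) (x : bundle u) :
  (x \in demand v p) = (payoff v p x == indirect_utility v p).
Proof.
apply/idP/eqP => [/demandP hx|e].
  by apply: le_anti; rewrite payoff_le hx.
by apply/demandP => y; rewrite e payoff_le.
Qed.

(** The price gaps between [p] and [raise p S] are 0 or 1, and the gap at the
    index 0 is 0. *)
Lemma common_demand_raise (n : nat) (u : {ffun 'I_n -> nat})
    (v : bundle u -> int) (p : price n) (S : {set 'I_n}) :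
  Mnat_concave v ->
  exists z, z \in demand v p /\ z \in demand v (raise p S).
Proof.
move=> hv; apply: common_demand_close hv _ (best_bundle_demand _ _)
  (best_bundle_demand _ _) => k l.
have gap j : - 1 <= price_at p j - price_at (raise p S) j <= 0.
  by case: j => [j|//] /=; rewrite ffunE; case: (_ \in _); lia.
by move: (gap k) (gap l); lia.
Qed.

Lemma payoff_raise (n : nat) (u : {ffun 'I_n -> nat}) (v : bundle u -> int)
    (p : price n) (X : {set 'I_n}) (x : bundle u) :
  payoff v (raise p X) x = payoff v p x - (\sum_(i in X) x i)%N%:Z.
Proof.
rewrite /payoff -addrA -opprD; congr (_ - _).
rewrite Posz_sum [X in _ + X]big_mkcond -big_split /=.
by apply: eq_bigr => i _; rewrite ffunE; case: (_ \in _); lia.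
Qed.

(** Optimality of [z] after the price increase says that [z] minimizes y(X)
    among the bundles that were demanded before. *)
Lemma mu_common_demand (n : nat) (u : {ffun 'I_n -> nat}) (v : bundle u -> int)
    (p : price n) (X : {set 'I_n}) (z : bundle u) :
  z \in demand v p -> z \in demand v (raise p X) ->
  mu v X p = (\sum_(i in X) z i)%N.
Proof.
move=> hz /demandP hzX; rewrite /mu.
have least y : y \in demand v p ->
    (\sum_(i in X) z i <= \sum_(i in X) y i)%N.
  have := hzX y; rewrite !payoff_raise !demandE in hz * => le_z /eqP ey.
  by move/eqP: hz le_z => ->; rewrite ey lerD2l lerN2 lez_nat.
apply/eqP; rewrite eqn_leq; apply/andP; split.
  exact: (@bigmin_le_cond _ nat _ _ z _ (fun y : bundle u => \sum_(i in X) y i)%N hz).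
apply: (@big_ind _ (fun k => \sum_(i in X) z i <= k)%N) => // [|a b ha hb].
  by apply: leq_sum => i _; rewrite -ltnS ltn_ord.
by rewrite leq_min ha.
Qed.

Lemma indirect_utility_raise (n : nat) (u : {ffun 'I_n -> nat})
    (v : bundle u -> int) (p : price n) (X : {set 'I_n}) :
  Mnat_concave v ->
  indirect_utility v (raise p X) = indirect_utility v p - (mu v X p)%:Z.
Proof.
move=> hv; have [z [hz hzX]] := common_demand_raise p X hv.
rewrite (mu_common_demand hz hzX); move: hz hzX.
by rewrite !demandE => /eqP <- /eqP <-; rewrite payoff_raise.
Qed.

(** * Midpoint convexity and the Lyapunov function *)

(** As r + s = 2 p + chi_S, the vectors [p] and [raise p S] are the midpoint of
    [r] and [s] rounded down and up: this is the discrete midpoint convexity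
    that characterizes L-natural-convex functions. *)
Definition midpoint_convex (n : nat) (g : price n -> int) : Prop :=
  forall (p : price n) (S : {set 'I_n}) (r s : price n),
    (forall i, r i + s i = p i + raise p S i)%N ->
    g p + g (raise p S) <= g r + g s.

(** A bundle demanded at both [p] and [raise p S] is available at [r] and [s],
    and the sum of its two payoffs depends only on the sum of the prices. *)
Lemma indirect_utility_midpoint (n : nat) (u : {ffun 'I_n -> nat})
    (v : bundle u -> int) :
  Mnat_concave v -> midpoint_convex (indirect_utility v).
Proof.
move=> hv p S r s e; have [z [hz hzS]] := common_demand_raise p S hv.
rewrite !demandE in hz hzS; rewrite -(eqP hz) -(eqP hzS).
have := payoff_le v r z; have := payoff_le v s z.
suff : payoff v p z + payoff v (raise p S) z = payoff v r z + payoff v s z by lia.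
rewrite /payoff ![_ - _ + (_ - _)]addrACA -!opprD -!big_split /=.
by congr (_ - _); apply: eq_bigr => i _; rewrite -!mulrDl -!PoszD e.
Qed.

Definition lyapunov (n m : nat) (u : {ffun 'I_n -> nat})
    (v : 'I_m -> bundle u -> int) (p : price n) : int :=
  \sum_(b < m) indirect_utility (v b) p + \sum_(i < n) (p i)%:Z * (u i)%:Z.

Lemma lyapunov_midpoint (n m : nat) (u : {ffun 'I_n -> nat})
    (v : 'I_m -> bundle u -> int) :
  (forall b, Mnat_concave (v b)) -> midpoint_convex (lyapunov v).
Proof.
move=> hv p S r s e; rewrite /lyapunov [leLHS]addrACA [leRHS]addrACA -!big_split /=.
apply: lerD; first by apply: ler_sum => b _; apply: indirect_utility_midpoint.
by apply: ler_sum => i _; rewrite -!mulrDl -!PoszD e.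
Qed.

Lemma lyapunov_raise (n m : nat) (u : {ffun 'I_n -> nat})
    (v : 'I_m -> bundle u -> int) (p : price n) (X : {set 'I_n}) :
  (forall b, Mnat_concave (v b)) ->
  lyapunov v (raise p X) =
    lyapunov v p + (\sum_(i in X) u i)%N%:Z - \sum_(b < m) (mu (v b) X p)%:Z.
Proof.
move=> hv; rewrite /lyapunov.
rewrite (eq_bigr _ (fun b _ => indirect_utility_raise p X (hv b))) sumrB.
suff -> : \sum_(i < n) (raise p X i)%:Z * (u i)%:Z =
    \sum_(i < n) (p i)%:Z * (u i)%:Z + (\sum_(i in X) u i)%N%:Z.
  by rewrite addrAC addrA.
rewrite Posz_sum [X in _ + X]big_mkcond -big_split /=.
by apply: eq_bigr => i _; rewrite ffunE; case: (_ \in _); lia.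
Qed.

(** The duality gap: since x exhausts the supply, the payments in the payoffs
    cancel the term p . u. *)
Lemma lyapunov_allocation (n m : nat) (u : {ffun 'I_n -> nat})
    (v : 'I_m -> bundle u -> int) (x : 'I_m -> bundle u) (p : price n) :
  allocation x ->
  lyapunov v p = \sum_(b < m) v b (x b) +
    \sum_(b < m) (indirect_utility (v b) p - payoff (v b) p (x b)).
Proof.
move=> hx; rewrite /lyapunov [X in _ = _ + X]sumrB /payoff.
rewrite [X in _ - X]sumrB [X in _ - (_ - X)]exchange_big /=.
suff -> : \sum_(i < n) \sum_(b < m) (p i)%:Z * (x b i : nat)%:Z =
    \sum_(i < n) (p i)%:Z * (u i)%:Z by rewrite opprB addrCA subrKC.
apply: eq_bigr => i _; rewrite -mulr_sumr; congr (_ * _).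
by have := hx i; rewrite -Posz_sum => ->.
Qed.

Lemma equilibrium_lyapunov (n m : nat) (u : {ffun 'I_n -> nat})
    (v : 'I_m -> bundle u -> int) (p : price n) (x : 'I_m -> bundle u) :
  allocation x ->
  equilibrium v p x <-> lyapunov v p <= \sum_(b < m) v b (x b).
Proof.
move=> hx; rewrite (lyapunov_allocation v p hx) gerDl.
have gap_ge0 b : 0 <= indirect_utility (v b) p - payoff (v b) p (x b).
  by rewrite subr_ge0 payoff_le.
split=> [[_ hd]|le0].
  rewrite big1 // => b _; apply/eqP; rewrite subr_eq0 eq_sym -demandE; exact: hd.
split=> // b; rewrite demandE eq_sym -subr_eq0.
have -> // := @psumr_eq0P _ _ predT _ (fun b _ => gap_ge0 b).
by apply: le_anti; rewrite le0 /=; exact: sumr_ge0.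
Qed.

Lemma equilibrium_price_min (n m : nat) (u : {ffun 'I_n -> nat})
    (v : 'I_m -> bundle u -> int) (q p : price n) :
  equilibrium_price v q -> lyapunov v q <= lyapunov v p.
Proof.
move=> [x hqx]; have hx := hqx.1.
have /(equilibrium_lyapunov v q hx) le_q := hqx.
apply: le_trans le_q _; rewrite (lyapunov_allocation v p hx) lerDl.
by apply: sumr_ge0 => b _; rewrite subr_ge0 payoff_le.
Qed.

Lemma equilibrium_price_of_min (n m : nat) (u : {ffun 'I_n -> nat})
    (v : 'I_m -> bundle u -> int) (q p : price n) :
  equilibrium_price v q -> lyapunov v p <= lyapunov v q -> equilibrium_price v p.
Proof.
move=> [x hqx] le_pq; have hx := hqx.1.
have /(equilibrium_lyapunov v q hx) le_q := hqx.
by exists x; apply/(equilibrium_lyapunov v p hx)/(le_trans le_pq).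
Qed.

(** * Submodularity and descent of midpoint convex functions *)

(** Raising Z costs less and less while prices outside Z go up.  One step
    raises all items that are still below [q] by 1: these are disjoint from Z,
    so the inequality for this step is an instance of midpoint convexity. *)
Lemma midpoint_convex_submodular (n : nat) (g : price n -> int)
    (r q : price n) (Z : {set 'I_n}) :
  midpoint_convex g -> price_le r q -> {in Z, forall i, r i = q i} ->
  g (raise q Z) + g r <= g (raise r Z) + g q.
Proof.
move=> hg; have [N] := ubnP (\sum_i (q i - r i))%N.
elim: N r => // N IHN r ltN le_rq eqZ.
have [/forallP e|/forallPn [j hj]] := boolP [forall i, r i == q i].
  by rewrite (_ : r = q) //; apply/ffunP => i; apply/eqP.
pose Y := [set i | (r i < q i)%N].
have le1 : price_le (raise r Y) q.
  by move=> i; rewrite ffunE inE; have := le_rq i; case: ltnP; lia.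
have eq1 : {in Z, forall i, raise r Y i = q i}.
  by move=> i /eqZ e; rewrite ffunE inE e ltnn addn0.
have lt1 : (\sum_i (q i - raise r Y i) < N)%N.
  apply: leq_trans (_ : _ < \sum_i (q i - r i))%N _; last by rewrite -ltnS.
  rewrite (bigD1 j) //= [ltnRHS](bigD1 j) //= -addSn; apply: leq_add.
    by rewrite ffunE inE; have := le_rq j; move: hj; case: ltnP; lia.
  by apply: leq_sum => i _; rewrite ffunE; lia.
have := IHN _ lt1 le1 eq1.
have eYZ : raise (raise r Y) Z = raise r (Y :|: Z).
  apply/ffunP => i; rewrite !ffunE !inE.
  by case: (boolP (i \in Z)) => [/eqZ ->|]; rewrite ?ltnn ?orbF; lia.
have /hg : forall i, (raise r Y i + raise r Z i = r i + raise r (Y :|: Z) i)%N.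
  by move=> i; rewrite -eYZ !ffunE; lia.
rewrite -eYZ; lia.
Qed.

(** Bisection: if [c] is not of the form [raise p X], one of the two rounded
    midpoints of [p] and [c] again has a value below that of [p], and both
    have a smaller total price than [c]. *)
Lemma midpoint_convex_descent (n : nat) (g : price n -> int) (p c : price n) :
  midpoint_convex g -> price_le p c -> g c < g p ->
  exists X : {set 'I_n}, g (raise p X) < g p.
Proof.
move=> hg; have [N] := ubnP (\sum_i c i)%N.
elim: N c => // N IHN c ltN le_pc lt_cp.
have [/forallP h1|/forallPn [j hj]] := boolP [forall i, (c i <= p i + 1)%N].
  exists [set i | (p i < c i)%N]; rewrite (_ : raise _ _ = c) //.
  apply/ffunP => i; rewrite ffunE inE; move: (h1 i) (le_pc i).
  by case: (ltnP (p i) (c i)) => /=; lia.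
(* [f] and [raise f S] are the midpoint rounded down and up; a coordinate [j]
   at distance at least 2 makes both of them smaller than [c]. *)
pose f : price n := [ffun i => ((p i + c i)./2)%N].
pose S := [set i | odd (p i + c i)].
have fS i : (f i + raise f S i = p i + c i)%N.
  by rewrite !ffunE inE; have := odd_double_half (p i + c i); lia.
have le_ff i : (f i <= raise f S i)%N by rewrite [raise _ _ _]ffunE leq_addr.
have ff_le i : (raise f S i <= f i + 1)%N.
  by rewrite [raise _ _ _]ffunE; case: (_ \in _); lia.
have lt_c (d : price n) : (forall i, (d i <= raise f S i)%N) -> (\sum_i d i < N)%N.
  move=> hd; apply: leq_trans (_ : _ < \sum_i c i)%N _; last by rewrite -ltnS.
  rewrite (bigD1 j) //= [ltnRHS](bigD1 j) //= -addSn; apply: leq_add.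
    by move: hj (hd j) (ff_le j) (fS j); lia.
  by apply: leq_sum => i _; move: (hd i) (ff_le i) (fS i) (le_pc i); lia.
have p_le (d : price n) : (forall i, (f i <= d i)%N) -> price_le p d.
  by move=> hd i; move: (hd i) (ff_le i) (fS i) (le_pc i); lia.
have := hg f S p c (fun i => esym (fS i)).
have [lt_f _|le_f le_sum] := ltP (g f) (g p).
  by apply: (IHN f) => //; [apply: lt_c | apply: p_le].
by apply: (IHN (raise f S)); [apply: lt_c | apply: p_le | lia].
Qed.

(** * The ascending auction *)

Lemma excess_demand_lyapunov (n m : nat) (u : {ffun 'I_n -> nat})
    (v : 'I_m -> bundle u -> int) (p : price n) (X Z : {set 'I_n}) :
  (forall b, Mnat_concave (v b)) -> excess_demand v p X ->
  Z != set0 -> Z \subset X ->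
  lyapunov v (raise p X) < lyapunov v (raise p (X :\: Z)).
Proof.
move=> hv [_ hX] Z0 ZX; have := hX Z Z0 ZX; rewrite !lyapunov_raise // sumrB.
have -> : (\sum_(i in X) u i = \sum_(i in Z) u i + \sum_(i in X :\: Z) u i)%N.
  by rewrite (big_setID Z) /= (setIidPr ZX).
set A := \sum_(b < m) (mu (v b) X p)%:Z.
set B := \sum_(b < m) (mu (v b) (X :\: Z) p)%:Z.
set a := (\sum_(i in Z) u i)%N; set c := (\sum_(i in X :\: Z) u i)%N.
lia.
Qed.

(** The items Z of X that already carry the price of [q] cannot be worth
    raising: by submodularity, raising them from p + chi_(X - Z) would lower
    the Lyapunov function at its minimizer [q] too. *)
Lemma excess_demand_raise_le (n m : nat) (u : {ffun 'I_n -> nat})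
    (v : 'I_m -> bundle u -> int) (p q : price n) (X : {set 'I_n}) :
  (forall b, Mnat_concave (v b)) -> equilibrium_price v q -> price_le p q ->
  excess_demand v p X -> price_le (raise p X) q.
Proof.
move=> hv hq le_pq hX.
pose Z := [set i in X | (q i <= p i)%N].
have ZX : Z \subset X by apply/subsetP => i; rewrite inE => /andP[].
have [Z0|Z0] := eqVneq Z set0.
  move=> i; rewrite ffunE; have := le_pq i.
  have : i \notin Z by rewrite Z0 inE.
  by rewrite inE; case: (i \in X); case: (leqP (q i) (p i)) => /=; lia.
have eX : raise (raise p (X :\: Z)) Z = raise p X.
  apply/ffunP => i; rewrite !ffunE in_setD.
  by have := subsetP ZX i; case: (i \in Z) => [/(_ isT) ->|_] /=; rewrite addn0.
have le_r : price_le (raise p (X :\: Z)) q.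
  move=> i; rewrite !ffunE !inE; have := le_pq i.
  by case: (i \in X); case: (leqP (q i) (p i)) => /=; lia.
have eq_r : {in Z, forall i, raise p (X :\: Z) i = q i}.
  move=> i iZ; have := le_r i; rewrite ffunE inE iZ /= addn0 => le1.
  by move: iZ; rewrite inE => /andP[_ le2]; lia.
have := midpoint_convex_submodular (lyapunov_midpoint hv) le_r eq_r.
have := excess_demand_lyapunov hv hX Z0 ZX.
have := equilibrium_price_min (raise q Z) hq.
by rewrite eX; lia.
Qed.

(** If [p] did not minimize the Lyapunov function, the descent from [p] towards
    the minimizer [q] would yield an overdemanded set. *)
Lemma no_overdemanded_eq_min (n m : nat) (u : {ffun 'I_n -> nat})
    (v : 'I_m -> bundle u -> int) (p q : price n) :
  (forall b, Mnat_concave (v b)) -> minimal_equilibrium_price v q ->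
  price_le p q -> ~~ has_overdemanded v p -> p = q.
Proof.
move=> hv [hq qmin] le_pq no_od; apply: qmin => //.
apply: equilibrium_price_of_min hq _; rewrite leNgt; apply: contra no_od => lt_qp.
have [X] := midpoint_convex_descent (lyapunov_midpoint hv) le_pq lt_qp.
rewrite lyapunov_raise // => ltX; apply/existsP; exists X; rewrite /overdemanded.
by move: ltX; rewrite ltrBlDr ltrD2l -Posz_sum ltz_nat.
Qed.

Theorem theorem3p3 (n m : nat) (u : {ffun 'I_n -> nat})
    (hu : forall i, (0 < u i)%N)
    (v : 'I_m -> bundle u -> int)
    (v_mono : forall b, monotone_valuation (v b))
    (v_zero : forall b (x : bundle u), bvec x = 0 -> v b x = 0)
    (v_Mnat : forall b, Mnat_concave (v b))
    (pmin : price n) (hpmin : minimal_equilibrium_price v pmin)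
    (p0 : price n) (hp0 : price_le p0 pmin)
    (p : nat -> price n) (X : nat -> {set 'I_n})
    (hrun : auction_run v p0 p X)
    (hX : forall t, has_overdemanded v (p t) -> excess_demand v (p t) (X t)) :
  stops_at v p pmin.
Proof.
case: hrun => p_init step.
have le_pmin t : price_le (p t) pmin.
  elim: t => [|t IHt]; first by rewrite p_init.
  have := step t; case: ifP => [od [_ ->]|_ -> //].
  exact: excess_demand_raise_le v_Mnat hpmin.1 IHt (hX t od).
have stops : exists T, ~~ has_overdemanded v (p T).
  (* After K iterations the total price would exceed that of [pmin]. *)
  pose K := (\sum_i pmin i).+1.
  have [/forallP od|/forallPn [T]] :=
    boolP [forall t : 'I_K, has_overdemanded v (p t)]; last by exists T.
  have grow t : (t <= K)%N -> (t <= \sum_i p t i)%N.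
    elim: t => // t IHt ltK.
    have od_t : has_overdemanded v (p t) := od (Ordinal ltK).
    have := step t; rewrite od_t => -[_ ->].
    have [/set0Pn [i iX] _] := hX t od_t.
    under eq_bigr => j _ do rewrite ffunE.
    rewrite big_split /= -addn1; apply: leq_add; first exact: IHt (ltnW ltK).
    by rewrite (bigD1 i) //= iX.
  have le_sum : (\sum_i p K i <= \sum_i pmin i)%N.
    by apply: leq_sum => i _; apply: le_pmin.
  by have := leq_trans (grow K (leqnn K)) le_sum; rewrite ltnn.
have [T stop first] := ex_minnP stops; exists T.
split=> // [t lt_t|]; last exact: no_overdemanded_eq_min v_Mnat hpmin (le_pmin _) stop.
by apply: contraLR lt_t => /first; rewrite -leqNgt.
Qed.
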